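(* Let $A\in\mathbb{R}^{m\times n}$, $b\in\mathbb{R}^m$, $c\in\mathbb{R}^n$ be LP data satisfying the Assumption in the context. Write the finite set $\mathcal{M}=\mathcal{M}_1\cup\mathcal{M}_2$ of edges of $\mathcal{F}_p$ emanating away from $\mathcal{X}^\star$ as $\mathcal{M}_1=\{\boldsymbol e^1,\dots,\boldsymbol e^{m_1}\}$, $\mathcal{M}_2=\{\boldsymbol f^1,\dots,\boldsymbol f^{m_2}\}$. For any given $\bar\varepsilon>0$, the LP sharpness $\mu_p$ is characterized as $$\mu_p=\min\left\{R_1(\boldsymbol e^1),R_1(\boldsymbol e^2),\dots,R_1(\boldsymbol e^{m_1}),R_2(\boldsymbol f^1;\bar\varepsilon),R_2(\boldsymbol f^2;\bar\varepsilon),\dots,R_2(\boldsymbol f^{m_2};\bar\varepsilon)\right\}.$$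
   Context: $\operatorname{Dist}$ is Euclidean distance to a set. Primal LP: $\min c^\top x$ s.t. $Ax=b,\ x\ge0$; dual: $\max b^\top y$ s.t. $A^\top y+s=c,\ s\ge0$. $V_p:=\{x\in\mathbb{R}^n:Ax=b\}$, $\mathcal{F}_p:=V_p\cap\mathbb{R}^n_+$, $\mathcal{X}^\star$ is the set of primal optimal solutions, $H_p^\star:=\{\hat x\in\mathbb{R}^n:c^\top\hat x=c^\top x^\star\}$ for any $x^\star\in\mathcal{X}^\star$. Assumption: the primal has an optimal solution, and both the primal and the dual have feasible solutions that are not optimal (for the dual, in the slack variable $s$). For $x\in\mathcal{F}_p\setminus\mathcal{X}^\star$ let $G(x):=\dfrac{\operatorname{Dist}(x,V_p\cap H_p^\star)}{\operatorname{Dist}(x,\mathcal{X}^\star)}$. LP sharpness: $\mu_p:=\inf_{x\in\mathcal{F}_p\setminus\mathcal{X}^\star}G(x)$. An edge of $\mathcal{F}_p$ is a 1-dimensional face. Each edge is either a segment $\boldsymbol e=[v^1,v^2]$ joining two distinct vertices of $\mathcal{F}_p$, or a half-line $\boldsymbol f=[v;r]=\{v+\theta r:\theta\ge0\}$ with $v$ a vertex and $r$ an extreme ray of $\mathcal{F}_p$. Define $\mathcal{M}_1:=\{\boldsymbol e=[v^1,v^2]:\boldsymbol e\text{ is an edge of }\mathcal{F}_p,\ v^1\in\mathcal{X}^\star,\ v^2\notin\mathcal{X}^\star\}$ and $\mathcal{M}_2:=\{\boldsymbol f=[v;r]:\boldsymbol f\text{ is an edge of }\mathcal{F}_p,\ v\in\mathcal{X}^\star,\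 c^\top r=1\}$ (so $r$ is normalized by $c^\top r=1$). For $\boldsymbol e=[x^\star,\tilde x]\in\mathcal{M}_1$ (with $x^\star\in\mathcal{X}^\star$, $\tilde x\notin\mathcal{X}^\star$) let $R_1(\boldsymbol e):=G(\tilde x)$; for $\boldsymbol f=[x^\star;r]\in\mathcal{M}_2$ and $\bar\varepsilon>0$ let $R_2(\boldsymbol f;\bar\varepsilon):=G(x^\star+\bar\varepsilon\, r)$. *)

(* Defs.v *)
From HB Require Import structures.
From mathcomp Require Import all_boot all_order all_algebra.
From mathcomp Require Import all_classical all_reals all_analysis.

Set Implicit Arguments.
Unset Strict Implicit.
Unset Printing Implicit Defensive.

Import Order.TTheory GRing.Theory Num.Theory.

Local Open Scope classical_set_scope.
Local Open Scope ring_scope.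

Section Euclidean.
Context {R : realType} {n : nat}.
Implicit Types (u v x y : 'cV[R]_n) (S : set 'cV[R]_n).

Definition dotp u v : R := (u^T *m v) 0 0.

(* The norm `|x| that MathComp puts on matrices is the sup norm. *)
Definition enorm u : R := Num.sqrt (dotp u u).

(* Meaningful for S !=set0 only: inf set0 = 0. *)
Definition Dist x S : R := inf [set enorm (x - y) | y in S].

End Euclidean.

Section Faces.
Context {R : realType} {n : nat}.
Implicit Types (P F S : set 'cV[R]_n) (v w r : 'cV[R]_n).

Definition face P F : Prop :=
  [/\ convex_set (F : set (convex_lmodType 'cV[R]_n)),
      F `<=` P &
      forall x y (t : R), P x -> P y -> 0 < t -> t < 1 ->
        F ((1 - t) *: x + t *: y) -> F x /\ F y].

(* The affine hull of S is x0 + U, where U is the least linear subspace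
   containing S - x0. *)
Definition affine_dim S (d : nat) : Prop :=
  exists2 x0, S x0 & exists U : {vspace 'cV[R]_n},
    [/\ \dim U = d,
        forall x, S x -> x - x0 \in U &
        forall W : {vspace 'cV[R]_n},
          (forall x, S x -> x - x0 \in W) -> (U <= W)%VS].

Definition edge P F : Prop := face P F /\ affine_dim F 1.

Definition vertex P v : Prop := face P [set v].

Definition closed_segment v w : set 'cV[R]_n :=
  [set (1 - t) *: v + t *: w | t in [set t : R | 0 <= t <= 1]].

Definition half_line v r : set 'cV[R]_n :=
  [set v + t *: r | t in [set t : R | 0 <= t]].

Definition recession_cone P : set 'cV[R]_n :=
  [set d | forall x (t : R), P x -> 0 <= t -> P (x + t *: d)].

Definition extreme_ray P r : Prop := edge (recession_cone P) (half_line 0 r).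

End Faces.

Section LinearProgram.
Context {R : realType} {m n : nat}.
Variables (A : 'M[R]_(m, n)) (b : 'cV[R]_m) (c : 'cV[R]_n).
Implicit Types (x v r s : 'cV[R]_n) (y : 'cV[R]_m).

Definition nonneg_orthant : set 'cV[R]_n := [set x | forall i, 0 <= x i 0].

Definition Vp : set 'cV[R]_n := [set x | A *m x = b].

Definition Fp : set 'cV[R]_n := Vp `&` nonneg_orthant.

Definition primal_opt : set 'cV[R]_n :=
  [set x | Fp x /\ forall z, Fp z -> dotp c x <= dotp c z].

Definition dual_feasible y s : Prop := A^T *m y + s = c /\ nonneg_orthant s.

Definition dual_optimal y s : Prop :=
  dual_feasible y s /\
  forall y' s', dual_feasible y' s' -> dotp b y' <= dotp b y.

Definition dual_slack : set 'cV[R]_n := [set s | exists y, dual_feasible y s].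

Definition dual_slack_opt : set 'cV[R]_n :=
  [set s | exists y, dual_optimal y s].

Definition lp_assumption : Prop :=
  [/\ primal_opt !=set0,
      Fp `\` primal_opt !=set0 &
      dual_slack `\` dual_slack_opt !=set0].

Definition Hp_star : set 'cV[R]_n :=
  [set x | exists2 xstar, primal_opt xstar & dotp c x = dotp c xstar].

Definition G x : R := Dist x (Vp `&` Hp_star) / Dist x primal_opt.

Definition mu_p : R := inf [set G x | x in Fp `\` primal_opt].

(* The edge [v1, v2] with v1 optimal and v2 not is encoded by the pair of its
   endpoints (v1, v2), which it determines. *)
Definition M1 : set ('cV[R]_n * 'cV[R]_n) :=
  [set e | [/\ edge Fp (closed_segment e.1 e.2),
               vertex Fp e.1, vertex Fp e.2,
               primal_opt e.1 & ~ primal_opt e.2]].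

(* The edge [v; r] is encoded by the pair (v, r), which it determines because
   c^T r = 1 fixes the scaling of r. *)
Definition M2 : set ('cV[R]_n * 'cV[R]_n) :=
  [set f | [/\ edge Fp (half_line f.1 f.2),
               vertex Fp f.1, extreme_ray Fp f.2,
               primal_opt f.1 & dotp c f.2 = 1]].

Definition R1 (e : 'cV[R]_n * 'cV[R]_n) : R := G e.2.

Definition R2 (f : 'cV[R]_n * 'cV[R]_n) (eps : R) : R := G (f.1 + eps *: f.2).

End LinearProgram.

Definition is_min {R : realType} (S : set R) (mu : R) : Prop :=
  S mu /\ lbound S mu.

(* Main.v *)
Require Import Defs.
From HB Require Import structures.
From mathcomp Require Import all_boot all_order all_algebra.
From mathcomp Require Import all_classical all_reals all_analysis.
From mathcomp Require Import ring lra.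

Set Implicit Arguments.
Unset Strict Implicit.
Unset Printing Implicit Defensive.

Import Order.TTheory GRing.Theory Num.Theory.

Local Open Scope classical_set_scope.
Local Open Scope ring_scope.

(** Write [gap x] for the excess [c^T x - f*] of the objective over its optimal
value and [X] for the optimal set.

Two level sets of [c] in the affine space [A x = b] are parallel, so the
distance from [x] to the optimal one is [gap x] times a constant
[unit_width] (lemma [Dist_opt_plane]).  Hence, up to that constant, minimizing
the sharpness ratio amounts to maximizing [Dist x X / gap x], where [Dist _ X]
is convex because [X] is, and [gap] is affine.  It suffices to show that a
bound [Dist p X <= K * gap p] valid at the finitely many distinguished points
[p] (the non-optimal endpoints of the bounded edges leaving [X], and the point
at parameter [eps] on the unbounded ones) holds at each feasible [x]; applied
with the largest ratio [K] at those points, this says that the best of them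
attains the infimum.

The bound propagates in three stages.
- Along an edge leaving [X], it passes from the distinguished point to the
  points closer to [X]: both sides vanish at the optimal end, the left one is
  convex and the right one is affine ([Dist_le_gap_edge]).
- Take [eps0 <= eps] smaller than the gap of each non-optimal vertex.  A point
  with [0 < gap x <= eps0] is moved along directions on which [A] and [c]
  vanish, within its own face, until a further coordinate becomes zero.  It is
  then a convex combination of two feasible points with the same gap and
  smaller support, or one such point plus a recession direction of [X], and
  neither operation can break the bound.  Once no such direction remains, the
  point lies on an edge of the feasible set, whose lower end is a vertex with
  gap at most [eps0], hence optimal ([Dist_le_gap_low]).
- A feasible point of arbitrary gap is pulled towards its (almost) nearest
  point of [X].  Along that segment the distance to [X] scales like the gap,
  so the bound at a point of gap at most [eps0] is the bound at the start
  ([Dist_shrink], [Dist_le_gap]).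

Faces are handled through supports: the face of a feasible [x] consists of the
feasible points whose support is contained in that of [x] ([face_supp],
[face_absorb]).  Thus vertices, and normalized extreme rays, are determined by
their supports, which gives finiteness. *)

(** * Euclidean norm and distance to a set *)

Section EuclideanDistance.
Context {R : realType} {n : nat}.
Implicit Types (u v w x y d : 'cV[R]_n) (S : set 'cV[R]_n).

Lemma dotpE u v : dotp u v = \sum_i u i 0 * v i 0.
Proof. by rewrite /dotp mxE; apply: eq_bigr => i _; rewrite mxE. Qed.

Lemma dotpC u v : dotp u v = dotp v u.
Proof. by rewrite !dotpE; apply: eq_bigr => i _; rewrite mulrC. Qed.

Lemma dotpDr u v w : dotp u (v + w) = dotp u v + dotp u w.
Proof. by rewrite /dotp mulmxDr mxE. Qed.

Lemma dotpZr a u v : dotp u (a *: v) = a * dotp u v.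
Proof. by rewrite /dotp -scalemxAr mxE. Qed.

Lemma dotpBr u v w : dotp u (v - w) = dotp u v - dotp u w.
Proof. by rewrite dotpDr -scaleN1r dotpZr mulN1r. Qed.

Lemma dotpDl u v w : dotp (v + w) u = dotp v u + dotp w u.
Proof. by rewrite !(dotpC _ u) dotpDr. Qed.

Lemma dotpZl a u v : dotp (a *: v) u = a * dotp v u.
Proof. by rewrite !(dotpC _ u) dotpZr. Qed.

Lemma dotp_ge0 u : 0 <= dotp u u.
Proof. by rewrite dotpE; apply: sumr_ge0 => i _; rewrite -expr2 sqr_ge0. Qed.

Lemma dotp_eq0 u : dotp u u = 0 -> u = 0.
Proof.
rewrite dotpE => /psumr_eq0P u0; apply/colP => i; rewrite mxE.
have /eqP : u i 0 * u i 0 = 0 by apply: u0 => // j _; rewrite -expr2 sqr_ge0.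
by rewrite mulf_eq0 orbb => /eqP.
Qed.

Lemma enorm_ge0 u : 0 <= enorm u.
Proof. exact: sqrtr_ge0. Qed.

Lemma enormZ a u : enorm (a *: u) = `|a| * enorm u.
Proof.
rewrite /enorm dotpZl dotpZr mulrA -expr2 sqrtrM ?sqr_ge0//.
by rewrite sqrtr_sqr.
Qed.

Lemma enorm_sqr u : enorm u ^+ 2 = dotp u u.
Proof. by rewrite sqr_sqrtr // dotp_ge0. Qed.

(** The squared norm of [|v|^2 u - (u.v) v] is [|v|^2 (|u|^2 |v|^2 - (u.v)^2)]. *)
Lemma cauchy_schwarz u v : dotp u v <= enorm u * enorm v.
Proof.
have [v0|v0] := eqVneq (dotp v v) 0.
  by rewrite (dotp_eq0 v0) -(scale0r 0) dotpZr mul0r mulr_ge0 ?enorm_ge0.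
have vgt0 : 0 < dotp v v by rewrite lt_def v0 dotp_ge0.
have : 0 <= dotp (dotp v v *: u - dotp u v *: v) (dotp v v *: u - dotp u v *: v).
  exact: dotp_ge0.
rewrite dotpBr !dotpDl -!scaleNr !dotpZl !dotpZr (dotpC v u) => H.
have {}H : 0 <= dotp v v * (dotp u u * dotp v v - dotp u v ^+ 2).
  by move: H; congr (_ <= _); ring.
rewrite pmulr_rge0// subr_ge0 in H.
apply: le_trans (ler_norm _) _.
rewrite -(@ler_pXn2r _ 2)// ?nnegrE ?mulr_ge0 ?enorm_ge0//.
by rewrite exprMn !enorm_sqr real_normK ?num_real.
Qed.

Lemma enormD u v : enorm (u + v) <= enorm u + enorm v.
Proof.
rewrite -(@ler_pXn2r _ 2)// ?nnegrE ?addr_ge0 ?enorm_ge0//.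
have := cauchy_schwarz u v.
rewrite sqrrD !enorm_sqr dotpDr !dotpDl (dotpC v u); lra.
Qed.

Lemma Dist_has_lbound x S : has_lbound [set enorm (x - y) | y in S].
Proof. by exists 0 => _ [y _ <-]; exact: enorm_ge0. Qed.

Lemma Dist_le x S y : S y -> Dist x S <= enorm (x - y).
Proof. by move=> Sy; apply: ge_inf (Dist_has_lbound x S) _ _; exists y. Qed.

Lemma Dist_lt x S a : S !=set0 -> Dist x S < a ->
  exists2 y, S y & enorm (x - y) < a.
Proof.
move=> [z Sz] /inf_lt[]; first by exists (enorm (x - z)), z.
by move=> _ [y Sy <-] ?; exists y.
Qed.

Lemma Dist_ge x S a : S !=set0 -> (forall y, S y -> a <= enorm (x - y)) ->
  a <= Dist x S.
Proof.
move=> [z Sz] H; apply: lb_le_inf; first by exists (enorm (x - z)), z.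
by move=> _ [y Sy <-]; exact: H.
Qed.

Lemma Dist_ge0 x S : S !=set0 -> 0 <= Dist x S.
Proof. by move=> S0; apply: Dist_ge => // y _; exact: enorm_ge0. Qed.

Lemma Dist_in x S : S x -> Dist x S = 0.
Proof.
move=> Sx; apply/eqP; rewrite eq_le Dist_ge0 ?andbT; last by exists x.
apply: le_trans (Dist_le _ Sx) _.
by rewrite subrr -(scale0r 0) enormZ normr0 mul0r.
Qed.

Lemma Dist_lipschitz x y S : S !=set0 -> Dist x S <= enorm (x - y) + Dist y S.
Proof.
move=> S0; rewrite -lerBlDl; apply: Dist_ge => // z Sz; rewrite lerBlDl.
apply: le_trans (Dist_le _ Sz) _.
have -> : x - z = (x - y) + (y - z) by rewrite addrA subrK.
exact: enormD.
Qed.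

Lemma Dist_convex x y t S : S !=set0 ->
  (forall v w, S v -> S w -> S ((1 - t) *: v + t *: w)) -> 0 <= t <= 1 ->
  Dist ((1 - t) *: x + t *: y) S <= (1 - t) * Dist x S + t * Dist y S.
Proof.
move=> S0 Sconv /andP[t0 t1]; apply/ler_addgt0Pr => e e0.
have [||v Sv xv] := @Dist_lt x S (Dist x S + e) => //; first by rewrite ltrDl.
have [||w Sw yw] := @Dist_lt y S (Dist y S + e) => //; first by rewrite ltrDl.
apply: le_trans (Dist_le _ (Sconv _ _ Sv Sw)) _.
have -> : (1 - t) *: x + t *: y - ((1 - t) *: v + t *: w) =
  (1 - t) *: (x - v) + t *: (y - w).
  by rewrite !scalerBr opprD addrACA.
apply: le_trans (enormD _ _) _; rewrite !enormZ !ger0_norm ?subr_ge0//.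
nra.
Qed.

(** Translating the comparison points along with [x] loses nothing when [S] is
stable under that translation. *)
Lemma Dist_recession x d S : S !=set0 -> (forall y, S y -> S (y + d)) ->
  Dist (x + d) S <= Dist x S.
Proof.
move=> S0 Sd; apply: Dist_ge => // y /Sd /Dist_le/le_trans; apply.
by rewrite opprD addrACA subrr addr0.
Qed.

(** If [y] were a nearest point of [S] to [x], moving [x] towards [y] until a
fraction [t] of the way is left would multiply the distance to [S] by [t].  The
quantification over all [y] in [S] stands in for a nearest point. *)
Lemma Dist_shrink x t a S : S !=set0 -> 0 < t <= 1 ->
  (forall y, S y -> Dist ((1 - t) *: y + t *: x) S <= a) -> t * Dist x S <= a.
Proof.
move=> S0 /andP[t0 t1] H.
have key y : S y -> Dist x S - a <= (1 - t) * enorm (x - y).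
  move=> Sy; have := Dist_lipschitz x ((1 - t) *: y + t *: x) S0.
  have -> : x - ((1 - t) *: y + t *: x) = (1 - t) *: (x - y).
    by apply/colP => i; rewrite !mxE; ring.
  rewrite enormZ ger0_norm ?subr_ge0//; have := H _ Sy; lra.
have [t1'|t1'] := eqVneq t 1.
  case: S0 => y /key; rewrite t1'; lra.
have t1'' : 0 < 1 - t by rewrite subr_gt0 lt_neqAle t1' t1.
have : (Dist x S - a) / (1 - t) <= Dist x S.
  by apply: Dist_ge => // y /key; rewrite ler_pdivrMr// mulrC.
rewrite ler_pdivrMr//; lra.
Qed.

End EuclideanDistance.

Section Supports.
Context {R : realType} {n : nat}.
Implicit Types (x y z v d r : 'cV[R]_n).

Definition supp x : {set 'I_n} := finset (fun i => x i 0 != 0).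

(** Inclusion of supports says that [d] vanishes on the coordinates where the
nonnegativity constraint is tight at [x]: [x] can be moved along [d]. *)
Lemma suppP d x :
  reflect (forall i, x i 0 = 0 -> d i 0 = 0) (supp d \subset supp x).
Proof.
apply: (iffP fintype.subsetP) => H i.
  move=> xi; have [//|di] := eqVneq (d i 0) 0.
  by have := H i; rewrite !inE xi eqxx di => /(_ isT).
by rewrite !inE; apply: contra_neq; exact: H.
Qed.

Lemma convex_setE (F : set 'cV[R]_n) :
  convex_set (F : set (convex_lmodType 'cV[R]_n)) <->
  forall x y (t : R), F x -> F y -> 0 <= t <= 1 -> F ((1 - t) *: x + t *: y).
Proof.
split=> H x y.
  move=> t Fx Fy t01.
  have := H y x (@Itv01 R t (proj1 (andP t01)) (proj2 (andP t01))).
  rewrite !inE => /(_ Fy Fx).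
  by rewrite /conv /= addrC.
move=> t; rewrite !inE => Fx Fy.
by rewrite /conv/= addrC; apply: H => //; apply/andP; split.
Qed.

End Supports.

(** * Faces of the feasible set in terms of supports *)

Section Faces.
Context {R : realType} {m n : nat}.
Variables (A : 'M[R]_(m, n)) (b : 'cV[R]_m).
Implicit Types (x y z v d r : 'cV[R]_n).

Lemma FpD x d t : A *m x = b -> A *m d = 0 ->
  (forall i, 0 <= x i 0 + t * d i 0) -> Fp A b (x + t *: d).
Proof.
move=> Ax Ad H; split => /=.
  by rewrite /Vp/= mulmxDr -scalemxAr Ad scaler0 addr0.
by move=> i; rewrite !mxE.
Qed.

Lemma Fp_convex x y (t : R) : Fp A b x -> Fp A b y -> 0 <= t <= 1 ->
  Fp A b ((1 - t) *: x + t *: y).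
Proof.
move=> [Ax x0] [Ay y0] /andP[t0 t1]; split => /=.
  rewrite /Vp/= mulmxDr -!scalemxAr Ax Ay -scalerDl subrK scale1r//.
by move=> i; rewrite !mxE addr_ge0// mulr_ge0// subr_ge0.
Qed.

(** The ratio test of the simplex method: [t] is the largest step along [d] that
keeps [x] feasible, and [j] is a coordinate that blocks a longer one. *)
Lemma ratio_step x d i0 : Fp A b x -> A *m d = 0 -> supp d \subset supp x ->
  d i0 0 < 0 ->
  exists t j, [/\ 0 < t, Fp A b (x + t *: d), d j 0 < 0 & x j 0 + t * d j 0 = 0].
Proof.
move=> [Ax x0] Ad /suppP dx di0.
pose F i := x i 0 / - d i 0.
case: (@arg_minP _ _ _ i0 (fun i => d i 0 < 0) F di0) => j dj jmin.
have xj : 0 < x j 0.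
  by rewrite lt_def x0 andbT; apply: contraTneq dj => /dx ->; rewrite ltxx.
exists (F j), j; split => //.
- by rewrite /F divr_gt0// oppr_gt0.
- apply: FpD => // i.
  have [di|di] := ltP (d i 0) 0; last first.
    by rewrite addr_ge0 ?x0// mulr_ge0// divr_ge0 ?x0// oppr_ge0 ltW.
  have := jmin _ di; rewrite {2}/F ler_pdivlMr ?oppr_gt0//; lra.
- by rewrite /F invrN mulrN mulNr divfK ?subrr ?lt_eqF.
Qed.

(** The blocking coordinate of the ratio test leaves the support; this is what
makes induction on the size of the support possible. *)
Lemma shrink_supp x d i0 : Fp A b x -> A *m d = 0 -> supp d \subset supp x ->
  d i0 0 < 0 -> exists t j, [/\ 0 < t, Fp A b (x + t *: d), d j 0 < 0,
    x j 0 + t * d j 0 = 0 &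
    supp (x + t *: d) \subset supp x /\ (#|supp (x + t *: d)| < #|supp x|)%N].
Proof.
move=> Px Ad dx di0; have [t [j [t0 Py dj yj]]] := ratio_step Px Ad dx di0.
have yx : supp (x + t *: d) \subset supp x.
  by apply/suppP => i xi; rewrite !mxE xi (suppP _ _ dx)// mulr0 addr0.
exists t, j; split => //; split => //.
apply: proper_card; rewrite fintype.properE yx/=; apply/fintype.subsetPn; exists j.
  rewrite !inE; apply: contraTneq dj => xj.
  by rewrite (suppP _ _ dx)// ltxx.
by rewrite !inE !mxE yj eqxx.
Qed.

(** [x] lies in the relative interior of the feasible points supported in
[supp x], so that a small move against [d] is always allowed. *)
Lemma step_back x d : Fp A b x -> A *m d = 0 -> supp d \subset supp x ->
  exists2 t, 0 < t & Fp A b (x - t *: d).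
Proof.
move=> Px Ad dx.
have Ad' : A *m (- d) = 0 by rewrite mulmxN Ad oppr0.
have [/existsP[i di]|/existsPn H] := boolP [exists i, (- d) i 0 < 0].
  have [|t [j [t0 P' _ _]]] := ratio_step Px Ad' _ di.
    by apply/suppP => k /(suppP _ _ dx); rewrite mxE => ->; rewrite oppr0.
  by exists t => //; rewrite -scalerN.
exists 1 => //; rewrite -scalerN; case: Px => Ax x0; apply: FpD => // i.
by rewrite addr_ge0 ?x0// mul1r leNgt H.
Qed.

Lemma face_supp x : face (Fp A b) [set z | Fp A b z /\ supp z \subset supp x].
Proof.
split.
- apply/convex_setE => y z t [Py /suppP yx] [Pz /suppP zx] t01; split.
    exact: Fp_convex.
  by apply/suppP => i xi; rewrite !mxE yx// zx// !mulr0 addr0.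
- by move=> z [].
- move=> y z t Py Pz t0 t1 [_ /suppP H].
  have H' i : x i 0 = 0 -> y i 0 = 0 /\ z i 0 = 0.
    move=> /H; rewrite !mxE; move: (Py.2 i) (Pz.2 i); nra.
  by split; split=> //; apply/suppP => i /H'[].
Qed.

(** Going from [y] through [x], one can step slightly beyond [x] and stay feasible.
Then [x] is interior to a feasible segment with endpoint [y], and the face [F]
must contain that endpoint. *)
Lemma face_absorb F x y : face (Fp A b) F -> F x -> Fp A b y ->
  supp y \subset supp x -> F y.
Proof.
move=> [_ FP Fext] Fx Py yx.
have Px := FP _ Fx.
have [||t t0 Pz] := @step_back x (y - x) Px.
- by rewrite mulmxBr Px.1 Py.1 subrr.
- by apply/suppP => i xi; rewrite !mxE xi (suppP _ _ yx)// subrr.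
have t1 : 0 < 1 + t by lra.
have [] := Fext _ _ (t / (1 + t)) Pz Py _ _ _ => //.
- by rewrite divr_gt0.
- by rewrite ltr_pdivrMr// mul1r; lra.
- move: Fx; congr F; apply/colP => i; rewrite !mxE; field.
  by rewrite lt0r_neq0.
Qed.

Lemma vertex_supp v : Fp A b v ->
  (forall d, A *m d = 0 -> supp d \subset supp v -> d = 0) -> vertex (Fp A b) v.
Proof.
move=> Pv H; rewrite /vertex.
suff <- : [set z | Fp A b z /\ supp z \subset supp v] = [set v] by exact: face_supp.
apply/seteqP; split => z /=; last by move=> ->.
move=> [Pz zv]; apply/eqP; rewrite -subr_eq0; apply/eqP/H.
  by rewrite mulmxBr Pz.1 Pv.1 subrr.
by apply/suppP => i vi; rewrite !mxE vi (suppP _ _ zv)// subrr.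
Qed.

Lemma finite_supp_inj (S : set 'cV[R]_n) :
  (forall x y, S x -> S y -> supp x = supp y -> x = y) -> finite_set S.
Proof.
move=> H; have /eq_finite_set <- : (supp @` S #= S)%card.
  by apply: inj_card_eq => x y; rewrite !inE; exact: H.
exact: finite_finset.
Qed.

Lemma finite_vertices : finite_set (vertex (Fp A b)).
Proof.
apply: finite_supp_inj => x y vx vy xy.
have Py : Fp A b y by case: vy => _ /(_ y erefl).
by have /= := @face_absorb _ x y vx erefl Py; rewrite xy => /(_ _)->.
Qed.

Lemma affine_dim_line F x d y s : d != 0 -> s != 0 -> F x -> y = x + s *: d ->
  F y -> (forall z, F z -> exists s', z = x + s' *: d) -> affine_dim F 1.
Proof.
move=> d0 s0 Fx -> Fy H; exists x => //; exists <[d]>%VS; split.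
- by rewrite dim_vline d0.
- by move=> z /H[s' ->]; apply/vlineP; exists s'; rewrite addrC addKr.
- move=> W HW; rewrite -memvE.
  have := HW _ Fy; rewrite addrC addKr => /(memvZ s^-1).
  by rewrite scalerA mulVf// scale1r.
Qed.

(** Throughout this section the directions along which [x] can be moved inside
its face are the multiples of [d], so that this face is an edge. *)
Section Line.
Variables (x d : 'cV[R]_n).
Hypotheses (Ad : A *m d = 0) (d0 : d != 0) (dx : supp d \subset supp x).
Hypothesis span : forall d', A *m d' = 0 -> supp d' \subset supp x ->
  exists s, d' = s *: d.

(** Two points of the face of [x] differ by a direction supported in [supp x],
hence by a multiple of [d]. *)
Lemma line_supp v t z : x = v + t *: d -> Fp A b v ->
  (Fp A b z /\ supp z \subset supp x) <-> exists2 s, z = v + s *: d & Fp A b z.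
Proof.
move=> xv Pv; split.
  move=> [Pz zx]; have [||s zs] := span (d' := z - x).
  - by rewrite mulmxBr Pz.1 xv mulmxDr Pv.1 -scalemxAr Ad scaler0 addr0 subrr.
  - by apply/suppP => i xi; rewrite !mxE xi (suppP _ _ zx)// subrr.
  exists (s + t) => //; rewrite -[LHS](subrK x) zs xv.
  by apply/colP => i; rewrite !mxE; ring.
move=> [s zs Pz]; split=> //; apply/suppP => i xi.
have di := suppP _ _ dx _ xi.
have := xi; rewrite xv zs !mxE di !mulr0 !addr0//.
Qed.

(** The coordinate [i] blocks moves beyond [v], and [j] blocks moves beyond the
other end. *)
Lemma edge_segment v t T i j : x = v + t *: d -> 0 < T ->
  Fp A b v -> Fp A b (v + T *: d) ->
  0 < d i 0 -> v i 0 = 0 -> d j 0 < 0 -> v j 0 + T * d j 0 = 0 ->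
  edge (Fp A b) (closed_segment v (v + T *: d)).
Proof.
move=> xv T0 Pv Pw di vi dj wj.
have FE : [set z | Fp A b z /\ supp z \subset supp x] = closed_segment v (v + T *: d).
  apply/seteqP; split => z /=.
    move=> /(line_supp _ xv Pv)[s zs Pz].
    have s0 : 0 <= s by have := Pz.2 i; rewrite zs !mxE vi add0r pmulr_lge0.
    have sT : s <= T.
      have := Pz.2 j; rewrite zs !mxE; nra.
    exists (s / T); first by rewrite /= divr_ge0 ?(ltW T0)// ler_pdivrMr ?mul1r.
    by rewrite zs; apply/colP => k; rewrite !mxE; field; rewrite lt0r_neq0.
  move=> [s s01 <-]; apply/(line_supp _ xv Pv); exists (s * T).
    by apply/colP => k; rewrite !mxE; ring.
  exact: Fp_convex.
split; first by rewrite -FE; exact: face_supp.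
apply: (@affine_dim_line _ v d (v + T *: d) T) => //; first exact: lt0r_neq0.
- exists 0; first by rewrite /= lexx ler01.
  by rewrite subr0 scale1r scale0r addr0.
- exists 1; first by rewrite /= lexx ler01.
  by rewrite subrr scale1r scale0r add0r.
- by move=> z; rewrite -FE => -[Pz zx]; have [s ? _] := (line_supp z xv Pv).1 (conj Pz zx); exists s.
Qed.

Lemma edge_half_line v t i : x = v + t *: d -> Fp A b v ->
  (forall k, 0 <= d k 0) -> 0 < d i 0 -> v i 0 = 0 ->
  edge (Fp A b) (half_line v d).
Proof.
move=> xv Pv dge0 di vi.
have FE : [set z | Fp A b z /\ supp z \subset supp x] = half_line v d.
  apply/seteqP; split => z /=.
    move=> /(line_supp _ xv Pv)[s zs Pz].
    exists s => //=; by have := Pz.2 i; rewrite zs !mxE vi add0r pmulr_lge0.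
  move=> [s /= s0 <-]; apply/(line_supp _ xv Pv); exists s => //.
  case: (Pv) => Av v0; apply: FpD => // k; exact: addr_ge0 (v0 k) (mulr_ge0 s0 (dge0 k)).
split; first by rewrite -FE; exact: face_supp.
apply: (@affine_dim_line _ v d (v + 1 *: d) 1) => //.
- by exists 0; rewrite /= ?lexx// scale0r addr0.
- by exists 1 => //=; exact: ler01.
- by move=> z; rewrite -FE => -[Pz zx]; have [s ? _] := (line_supp z xv Pv).1 (conj Pz zx); exists s.
Qed.

End Line.

(** The recession cone is again the feasible set of a linear program in standard
form, so that everything proved about faces applies to extreme rays too. *)
Lemma recession_coneE : Fp A b !=set0 -> recession_cone (Fp A b) = Fp A 0.
Proof.
move=> [x Px]; apply/seteqP; split => d /=.
  move=> H; split => /=.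
    have := (H _ _ Px ler01).1; rewrite /Vp/= scale1r mulmxDr Px.1.
    by move=> /eqP; rewrite addrC -subr_eq0 addrK => /eqP.
  move=> i; rewrite leNgt; apply/negP => di.
  have t0 : 0 <= (x i 0 + 1) / - d i 0.
    by rewrite divr_ge0 ?oppr_ge0 ?(ltW di)// addr_ge0 ?ler01// Px.2.
  have := (H _ _ Px t0).2 i; rewrite !mxE invrN mulrN mulNr divfK ?lt_eqF//; lra.
move=> [Ad d0] y t [Ay y0] t0; apply: FpD => // i.
exact: addr_ge0 (y0 i) (mulr_ge0 t0 (d0 i)).
Qed.

End Faces.

(** * Points of maximal value in a finite set *)

Section FiniteMax.
Context {R : realType} {T : eqType}.

Lemma finite_set_max (E : set T) (f : T -> R) : finite_set E -> E !=set0 ->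
  exists2 p, E p & forall q, E q -> f q <= f p.
Proof.
move=> /finite_seqP[s ->] [q0 /= q0s] {E}.
suff [p ps pmax] : exists2 p, p \in s & {in s, forall q, f q <= f p} by exists p.
elim: s q0 q0s => [//|p s IH] _ _.
case: s IH => [|q s] IH; first by exists p; rewrite ?mem_head// => q /[!inE]/eqP->.
have [|p' p's p'max] := IH q; first exact: mem_head.
have [pp'|p'p] := leP (f p) (f p').
  by exists p' => [|q']; rewrite inE ?p's ?orbT// => /predU1P[->//|]; exact: p'max.
exists p => [|q']; rewrite inE ?eqxx// => /predU1P[->//|/p'max/le_trans]; apply.
exact: ltW.
Qed.

End FiniteMax.

(** * Sharpness and the edges leaving the optimal set *)

Section Sharpness.
Context {R : realType} {m n : nat}.
Variables (A : 'M[R]_(m, n)) (b : 'cV[R]_m) (c : 'cV[R]_n) (xopt : 'cV[R]_n).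
Hypothesis opt_xopt : primal_opt A b c xopt.
Implicit Types (x y z v d r : 'cV[R]_n).

Local Notation P := (Fp A b).
Local Notation X := (primal_opt A b c).

Definition gap x : R := dotp c x - dotp c xopt.

Lemma gapD x d t : gap (x + t *: d) = gap x + t * dotp c d.
Proof. by rewrite /gap dotpDr dotpZr addrAC. Qed.

Lemma gap_convex x y t : gap ((1 - t) *: x + t *: y) = (1 - t) * gap x + t * gap y.
Proof. by rewrite /gap dotpDr !dotpZr; ring. Qed.

Lemma gap_ge0 x : P x -> 0 <= gap x.
Proof. by move=> Px; rewrite subr_ge0; exact: opt_xopt.2. Qed.

Lemma gap_opt x : X x -> gap x = 0.
Proof.
move=> [Px xmin]; apply/eqP; rewrite eq_le gap_ge0// andbT subr_le0.
exact: xmin opt_xopt.1.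
Qed.

Lemma opt_gap x : P x -> gap x <= 0 -> X x.
Proof.
move=> Px; rewrite subr_le0 => H; split=> // z Pz.
exact: le_trans H (opt_xopt.2 _ Pz).
Qed.

Lemma gap_gt0 x : P x -> ~ X x -> 0 < gap x.
Proof. by move=> Px Xx; rewrite ltNge; apply/negP => /(opt_gap Px). Qed.

Lemma opt_nonempty : X !=set0. Proof. by exists xopt. Qed.

Lemma opt_convex t v w : 0 <= t <= 1 -> X v -> X w -> X ((1 - t) *: v + t *: w).
Proof.
move=> t01 Xv Xw; apply: opt_gap; first exact: Fp_convex Xv.1 Xw.1 t01.
by rewrite gap_convex !gap_opt// !mulr0 addr0.
Qed.

Lemma Dist_opt_convex x y t : 0 <= t <= 1 ->
  Dist ((1 - t) *: x + t *: y) X <= (1 - t) * Dist x X + t * Dist y X.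
Proof.
move=> t01; apply: Dist_convex => //; first exact: opt_nonempty.
by move=> v w; exact: opt_convex.
Qed.

(** By Cauchy-Schwarz the distance from [x] to an optimal point is at least
[gap x] divided by the norm of [c]. *)
Lemma Dist_opt_gt0 x : P x -> ~ X x -> 0 < Dist x X.
Proof.
move=> Px Xx; have g0 := gap_gt0 Px Xx.
have H y : X y -> gap x <= enorm c * enorm (x - y).
  move=> Xy; apply: le_trans (cauchy_schwarz _ _).
  by rewrite dotpBr -(subr0 (gap x)) -(gap_opt Xy) /gap; lra.
have c0 : 0 < enorm c.
  rewrite lt_def enorm_ge0 andbT; apply: contraTneq (H _ opt_xopt) => ->.
  by rewrite mul0r -ltNge.
apply: lt_le_trans (Dist_ge (a := gap x / enorm c) opt_nonempty _).
  by rewrite divr_gt0.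
by move=> y /H; rewrite ler_pdivrMr// mulrC.
Qed.

Lemma Hp_starE : Hp_star A b c = [set x | gap x = 0].
Proof.
apply/seteqP; split=> x /=; rewrite /gap.
  by move=> [z /gap_opt]; rewrite /gap => z0 ->.
by move=> /eqP; rewrite subr_eq0 => /eqP; exists xopt.
Qed.

(** The distance between two level sets of [c] in [A x = b] whose values of [c]
differ by one; it does not depend on the chosen pair. *)
Definition unit_width : R := Dist 0 [set d | A *m d = 0 /\ dotp c d = -1].

(** The displacements from [x] to the optimal level set are [gap x] times the
displacements that lower [c] by one. *)
Lemma Dist_opt_plane x : Vp A b x -> 0 < gap x ->
  Dist x (Vp A b `&` Hp_star A b c) = gap x * unit_width.
Proof.
rewrite Hp_starE => Vx g0.
have Vd d t : A *m d = 0 -> Vp A b (x + t *: d).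
  by move=> Ad; rewrite /Vp/= mulmxDr -scalemxAr Ad scaler0 addr0.
have Vxopt : A *m xopt = b := opt_xopt.1.1.
apply/eqP; rewrite eq_le; apply/andP; split.
  rewrite mulrC -ler_pdivrMr//; apply: Dist_ge.
    exists ((gap x)^-1 *: (xopt - x)); split => /=.
      by rewrite -scalemxAr mulmxBr Vx Vxopt subrr scaler0.
    by rewrite dotpZr dotpBr -opprB mulrN mulVf ?gt_eqF.
  move=> d [Ad cd]; rewrite ler_pdivrMr// mulrC.
  have /le_trans -> // : Dist x (Vp A b `&` [set x | gap x = 0]) <= enorm (x - (x + gap x *: d)).
    by apply: Dist_le; split => /=; [exact: Vd|rewrite gapD cd mulrN1 subrr].
  have -> : x - (x + gap x *: d) = gap x *: (0 - d).
    by apply/colP => i; rewrite !mxE; ring.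
  by rewrite enormZ gtr0_norm.
apply: Dist_ge.
  by exists xopt; split => //=; rewrite gap_opt.
move=> y [Vy gy]; rewrite mulrC -ler_pdivlMr//.
have -> : enorm (x - y) / gap x = enorm (0 - (gap x)^-1 *: (y - x)).
  have -> : 0 - (gap x)^-1 *: (y - x) = (gap x)^-1 *: (x - y).
    by apply/colP => i; rewrite !mxE; ring.
  by rewrite enormZ gtr0_norm ?invr_gt0// mulrC.
apply: Dist_le; split => /=.
  by rewrite -scalemxAr mulmxBr Vx Vy subrr scaler0.
rewrite dotpZr; have -> : dotp c (y - x) = gap y - gap x by rewrite dotpBr /gap; ring.
by rewrite gy sub0r mulrN mulVf ?gt_eqF.
Qed.

Lemma GE x : P x -> ~ X x -> G A b c x = unit_width * (gap x / Dist x X).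
Proof.
by move=> Px Xx; rewrite /G Dist_opt_plane ?gap_gt0//; [ring|exact: Px.1].
Qed.

Lemma unit_width_ge0 x : P x -> ~ X x -> 0 <= unit_width.
Proof.
move=> Px Xx; have g0 := gap_gt0 Px Xx.
rewrite -(pmulr_rge0 _ g0) -Dist_opt_plane//; last exact: Px.1.
apply: Dist_ge0; exists xopt; split; first exact: opt_xopt.1.1.
by rewrite Hp_starE /= gap_opt.
Qed.

Variable eps : R.
Hypothesis eps_gt0 : 0 < eps.

(** On a bounded edge the ratio is smallest at the far end; on an unbounded one,
where [c] grows at unit rate, [eps] is the gap of the chosen point. *)
Definition edge_ends : set 'cV[R]_n :=
  [set e.2 | e in M1 A b c] `|` [set f.1 + eps *: f.2 | f in M2 A b c].

Lemma edge_ends_sub : edge_ends `<=` P `\` X.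
Proof.
move=> _ [[[v w] [_ _ Vw _ Xw] <-]|[[v r] [[[_ FP _] _] _ _ Xv /= cr] <-]] /=.
  by split=> //; case: Vw => _ /(_ _ erefl).
split; first by apply: FP; exists eps => //=; exact: ltW.
by move=> /gap_opt; rewrite gapD gap_opt// add0r cr mulr1; apply/eqP; rewrite gt_eqF.
Qed.

Lemma finite_M1 : finite_set (M1 A b c).
Proof.
apply: (@sub_finite_set _ _ (vertex P `*` vertex P)).
  by move=> e [_ ? ? _ _].
by apply: finite_setX; exact: finite_vertices.
Qed.

Lemma finite_M2 : finite_set (M2 A b c).
Proof.
apply: (@sub_finite_set _ _ (vertex P `*` [set r | extreme_ray P r /\ dotp c r = 1])).
  by move=> e [_ ? ? _ ?].
apply: finite_setX; first exact: finite_vertices.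
apply: finite_supp_inj => r r' [[+ _] cr] [[+ _] cr'] rr'.
rewrite recession_coneE; last by exists xopt; exact: opt_xopt.1.
move=> Fr [_ FP _].
have in_half_line (u : 'cV[R]_n) : half_line 0 u u.
  by exists 1; rewrite /= ?ler01// scale1r add0r.
have := face_absorb Fr (in_half_line r) (FP _ (in_half_line r')).
rewrite rr' => /(_ (fintype.subxx _))[t /= _]; rewrite add0r => tr.
by move: cr'; rewrite -tr dotpZr cr mulr1 => ->; rewrite scale1r.
Qed.

(** Here [K] bounds the ratio of distance to gap at the distinguished points, and
the level [eps0] separates the optimal vertices from the others. *)
Section LowLevel.
Variables (K eps0 : R).
Hypothesis vertex_gap : forall v, vertex P v -> ~ X v -> eps0 < gap v.
Hypothesis eps0_le : eps0 <= eps.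
Hypothesis end_le : forall p, edge_ends p -> Dist p X <= K * gap p.

Lemma vertex_low v : vertex P v -> gap v <= eps0 -> X v.
Proof.
move=> Vv gv; have [//|/(vertex_gap Vv)] := pselect (X v).
by rewrite ltNge gv.
Qed.

(** The case where [x] is alone in its level set within its face.  Going down
along [- d] must stop, because the gap cannot become negative; it stops at a
vertex [v], which is optimal as its gap is at most [eps0].  Going up along [d]
either stops at another vertex, which gives a bounded edge, or does not, which
gives an unbounded one. *)
Lemma Dist_le_gap_edge x d : P x -> 0 < gap x <= eps0 ->
  A *m d = 0 -> supp d \subset supp x -> dotp c d = 1 ->
  (forall d', A *m d' = 0 -> supp d' \subset supp x -> exists s, d' = s *: d) ->
  Dist x X <= K * gap x.
Proof.
move=> Px /andP[gx0 gxe] Ad dx cd span.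
have d0 : d != 0 by apply: contra_eq_neq cd => ->; rewrite /dotp mulmx0 mxE eq_sym oner_neq0.
have Ad' : A *m (- d) = 0 by rewrite mulmxN Ad oppr0.
have dx' : supp (- d) \subset supp x.
  by apply/suppP => i xi; rewrite mxE (suppP _ _ dx)// oppr0.
(* A point of this edge where a coordinate of [d] blocks is a vertex: being
   supported off [j] forces multiples of [d] to vanish. *)
have end_vertex v j : P v -> supp v \subset supp x -> d j 0 != 0 -> v j 0 = 0 -> vertex P v.
  move=> Pv vx dj vj; apply: vertex_supp => // d' Ad'' d'v.
  have [|s d's] := span d' Ad''; first exact: fintype.subset_trans d'v vx.
  have /eqP := suppP _ _ d'v _ vj; rewrite d's mxE mulf_eq0 (negbTE dj) orbF.
  by move=> /eqP ->; rewrite scale0r.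
(* Otherwise a step of length [gap x + 1] would reach a gap of [-1]. *)
have [i di] : exists i, (- d) i 0 < 0.
  apply: contrapT => /forallNP H.
  have Py : P (x + (- (gap x + 1)) *: d).
    apply: FpD Px.1 Ad _ => i; have := H i; rewrite mxE => /negP; rewrite -leNgt => di.
    have := Px.2 i; nra.
  have := gap_ge0 Py; rewrite gapD cd; lra.
have [t [j [t0 Pv dj vj [vx _]]]] := shrink_supp Px Ad' dx' di.
set v := x + t *: - d in Pv vx.
rewrite mxE oppr_lt0 in dj.
have vj0 : v j 0 = 0 by rewrite /v !mxE -[RHS]vj mxE.
have Vv : vertex P v by apply: (end_vertex v j) => //; rewrite gt_eqF.
have gv : gap v = gap x - t by rewrite /v scalerN -scaleNr gapD cd mulr1.
have Xv : X v by apply: vertex_low => //; lra.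
have tx : t = gap x by have := gap_opt Xv; lra.
have xv : x = v + t *: d by rewrite /v scalerN subrK.
have Dv : Dist v X = 0 by exact: Dist_in.
have [[k dk]|/forallNP dge] := pselect (exists k, d k 0 < 0).
  have [t' [l [t'0 Pw dl wl [wx _]]]] := shrink_supp Px Ad dx dk.
  set w := x + t' *: d in Pw wx.
  have wv : w = v + (t + t') *: d by rewrite /w xv scalerDl addrA.
  have wl0 : w l 0 = 0 by rewrite /w !mxE.
  have Vw : vertex P w by apply: (end_vertex w l) => //; rewrite lt_eqF.
  have gw : gap w = t + t' by rewrite /w gapD cd; lra.
  have Xw : ~ X w by move=> /gap_opt; lra.
  have tt' : 0 < t + t' by lra.
  have Mw : edge_ends w.
    left; exists (v, w) => //; split => //=; rewrite wv.
    apply: (@edge_segment _ _ _ _ _ x _ _ _ _ _ _ t _ j l) => //.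
    - by rewrite -wv.
    - by move: wl0; rewrite wv !mxE.
  have -> : x = (1 - t / (t + t')) *: v + (t / (t + t')) *: w.
    by rewrite wv {1}xv; apply/colP => q; rewrite !mxE; field; rewrite gt_eqF.
  apply: le_trans (Dist_opt_convex _ _ _) _.
    by rewrite divr_ge0 ?(ltW t0) ?(ltW tt')//= ler_pdivrMr// mul1r; lra.
  rewrite gap_convex Dv (gap_opt Xv) !mulr0 !add0r mulrCA ler_wpM2l//.
    by rewrite divr_ge0 ?ltW.
  exact: end_le.
have {}dge q : 0 <= d q 0 by have := dge q; rewrite leNgt => /negP.
have Mp : edge_ends (v + eps *: d).
  right; exists (v, d) => //; split => //=.
    exact: (@edge_half_line _ _ _ _ _ x _ _ _ _ _ _ t j).
  rewrite /extreme_ray recession_coneE; last by exists x.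
  apply: (@edge_half_line _ _ _ _ _ d _ _ _ _ _ _ 1 j) => //.
  - by move=> d' Ad'' d'd; apply: span => //; exact: fintype.subset_trans d'd dx.
  - by rewrite scale1r add0r.
  - by split; rewrite /= ?/Vp/= ?mulmx0// => q; rewrite mxE.
  - by rewrite mxE.
have -> : x = (1 - t / eps) *: v + (t / eps) *: (v + eps *: d).
  by rewrite {1}xv; apply/colP => q; rewrite !mxE; field; rewrite gt_eqF.
apply: le_trans (Dist_opt_convex _ _ _) _.
  by rewrite divr_ge0 ?(ltW t0) ?(ltW eps_gt0)//= ler_pdivrMr// mul1r tx (le_trans gxe).
rewrite gap_convex Dv (gap_opt Xv) !mulr0 !add0r mulrCA ler_wpM2l//.
  by rewrite divr_ge0 ?ltW.
exact: end_le.
Qed.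

(** Induction on the size of the support, by moving [x] inside its level set and
its face as long as possible. *)
Lemma Dist_le_gap_low x : P x -> 0 < gap x <= eps0 -> Dist x X <= K * gap x.
Proof.
have [k] := ubnP #|supp x|; elim: k x => [//|k IH] x; rewrite ltnS => xk Px gx.
have {IH}IH y : (#|supp y| < #|supp x|)%N -> P y -> gap y = gap x -> Dist y X <= K * gap x.
  by move=> yx Py gy; rewrite -gy; apply: IH => //; [exact: leq_trans yx xk|rewrite gy].
have [[d [Ad dx cd d0]]|H] := pselect (exists d,
    [/\ A *m d = 0, supp d \subset supp x, dotp c d = 0 & d != 0]).
  (* Up to replacing [d] by its opposite, moving along [d] is blocked. *)
  wlog [i di] : d Ad dx cd d0 / exists i, d i 0 < 0.
    move=> W; have [[i di]|/forallNP dge] := pselect (exists i, d i 0 < 0).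
      by apply: (W d) => //; exists i.
    apply: (W (- d)); rewrite ?mulmxN ?Ad ?oppr0 ?oppr_eq0//.
    - by apply/suppP => i xi; rewrite mxE (suppP _ _ dx)// oppr0.
    - by rewrite -scaleN1r dotpZr cd mulr0.
    - apply: contrapT => /forallNP dle; move/eqP : d0; apply.
      apply/colP => i; have := dge i; have := dle i; rewrite !mxE oppr_lt0 => /negP + /negP.
      by rewrite -!leNgt => ? ?; apply/eqP; rewrite eq_le; apply/andP.
  have [t [j [t0 Py _ _ [_ yx]]]] := shrink_supp Px Ad dx di.
  have Dy : Dist (x + t *: d) X <= K * gap x.
    by apply: IH => //; rewrite gapD cd mulr0 addr0.
  have Ad' : A *m (- d) = 0 by rewrite mulmxN Ad oppr0.
  have dx' : supp (- d) \subset supp x.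
    by apply/suppP => l xl; rewrite mxE (suppP _ _ dx)// oppr0.
  have [[l dl]|/forallNP dle] := pselect (exists l, (- d) l 0 < 0).
    have [t' [j' [t'0 Pz _ _ [_ zx]]]] := shrink_supp Px Ad' dx' dl.
    have Dz : Dist (x + t' *: - d) X <= K * gap x.
      by apply: IH => //; rewrite scalerN -scaleNr gapD cd mulr0 addr0.
    have tt' : 0 < t + t' by lra.
    have {1}-> : x = (1 - t / (t + t')) *: (x + t *: d) + (t / (t + t')) *: (x + t' *: - d).
      by apply/colP => q; rewrite !mxE; field; rewrite gt_eqF.
    have s01 : 0 <= t / (t + t') <= 1.
      by rewrite divr_ge0 ?(ltW t0) ?(ltW tt')//= ler_pdivrMr// mul1r; lra.
    apply: le_trans (Dist_opt_convex _ _ s01) _.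
    move: s01; set s := t / _; nra.
  (* Moving along [- d] is not blocked: it is a recession direction of [X]. *)
  apply: le_trans Dy.
  have {1}-> : x = (x + t *: d) + t *: - d by rewrite scalerN addrK.
  apply: Dist_recession; first exact: opt_nonempty.
  move=> y Xy; apply: opt_gap; last first.
    by rewrite scalerN -scaleNr gapD cd mulr0 addr0 gap_opt.
  apply: FpD Xy.1.1 Ad' _ => l.
  rewrite addr_ge0 ?Xy.1.2// mulr_ge0 ?(ltW t0)// leNgt; exact/negP/dle.
have {}H d : A *m d = 0 -> supp d \subset supp x -> dotp c d = 0 -> d = 0.
  move=> Ad dx cd; apply: contrapT => /eqP d0; apply: H; by exists d.
have [[d [Ad dx d0]]|Hv] := pselect (exists d, [/\ A *m d = 0, supp d \subset supp x & d != 0]).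
  have cd0 : dotp c d != 0 by apply: contra_neq d0; exact: H.
  apply: (@Dist_le_gap_edge x ((dotp c d)^-1 *: d)) => //.
  - by rewrite -scalemxAr Ad scaler0.
  - by apply/suppP => i xi; rewrite mxE (suppP _ _ dx)// mulr0.
  - by rewrite dotpZr mulVf.
  move=> d' Ad' d'x; exists (dotp c d'); rewrite scalerA.
  apply/eqP; rewrite -subr_eq0; apply/eqP; apply: H.
  - by rewrite mulmxBr Ad' -scalemxAr Ad scaler0 subrr.
  - by apply/suppP => i xi; rewrite !mxE (suppP _ _ dx)// (suppP _ _ d'x)// mulr0 subrr.
  - by rewrite dotpBr dotpZr divfK// subrr.
have Vx : vertex P x.
  apply: vertex_supp => // d Ad dx; apply: contrapT => /eqP d0.
  by apply: Hv; exists d.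
have /gap_opt gx0 := vertex_low Vx (proj2 (andP gx)).
by move: gx; rewrite gx0 ltxx.
Qed.

(** The factor [t] brings the gap of [x] down to at most [eps0]. *)
Lemma Dist_le_gap x : 0 < eps0 -> P x -> ~ X x -> Dist x X <= K * gap x.
Proof.
move=> e0 Px Xx; have g0 := gap_gt0 Px Xx.
pose t := Num.min 1 (eps0 / gap x).
have t0 : 0 < t by rewrite lt_min ltr01 divr_gt0.
have t1 : t <= 1 by rewrite ge_min lexx.
have tg : t * gap x <= eps0 by rewrite -ler_pdivlMr// ge_min lexx orbT.
rewrite -(ler_pM2l t0) mulrCA; apply: Dist_shrink opt_nonempty _ _.
  by rewrite t0 t1.
move=> y Xy.
have gy : gap ((1 - t) *: y + t *: x) = t * gap x.
  by rewrite gap_convex (gap_opt Xy) mulr0 add0r.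
rewrite -gy; apply: Dist_le_gap_low.
  by apply: Fp_convex => //; [exact: Xy.1|rewrite (ltW t0) t1].
by rewrite gy mulr_gt0.
Qed.

End LowLevel.

Lemma vertex_gap_bound : exists eps0, [/\ 0 < eps0, eps0 <= eps &
  forall v, vertex P v -> ~ X v -> eps0 < gap v].
Proof.
pose V := vertex P `\` X.
have [V0|V0] := pselect (V !=set0); last first.
  by exists eps; split => // v Vv Xv; case: V0; exists v.
have finV : finite_set V by apply: sub_finite_set (finite_vertices A b) => v [].
have [v [Vv Xv] vmin] := finite_set_max (fun v => - gap v) finV V0.
have gv : 0 < gap v by apply: gap_gt0 => //; case: Vv => _ /(_ _ erefl).
exists (Num.min eps (gap v / 2)); split.
- by rewrite lt_min eps_gt0 divr_gt0.
- by rewrite ge_min lexx.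
- move=> w Vw Xw; have := vmin w (conj Vw Xw); rewrite lerN2 => vw.
  by rewrite gt_min; apply/orP; right; lra.
Qed.

(** The minimizer is the distinguished point at which the ratio of distance to
gap is largest; that largest ratio serves as [K] in [Dist_le_gap]. *)
Lemma sharpest_edge_end : P `\` X !=set0 ->
  exists2 p, edge_ends p & forall x, (P `\` X) x -> G A b c p <= G A b c x.
Proof.
move=> [x0 [Px0 Xx0]].
have [eps0 [e0 e0le Hv]] := vertex_gap_bound.
(* Without distinguished points, [K := 0] would be a valid bound. *)
have ends0 : edge_ends !=set0.
  apply: contrapT => E0.
  have : Dist x0 X <= 0 * gap x0.
    by apply: (Dist_le_gap Hv) => // p Ep; case: E0; exists p.
  by rewrite mul0r leNgt Dist_opt_gt0.
have endsfin : finite_set edge_ends.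
  rewrite finite_setU; split; apply: finite_image; [exact: finite_M1|exact: finite_M2].
have [p Ep pmax] := finite_set_max (fun p => Dist p X / gap p) endsfin ends0.
exists p => // x [Px Xx].
have [Pp Xp] := edge_ends_sub Ep.
have H q : edge_ends q -> Dist q X <= Dist p X / gap p * gap q.
  by move=> Eq; have [Pq Xq] := edge_ends_sub Eq; rewrite -ler_pdivrMr ?gap_gt0//; exact: pmax.
have := Dist_le_gap Hv e0le H e0 Px Xx.
rewrite !GE// => Dx; apply: ler_wpM2l; first exact: unit_width_ge0 Px Xx.
rewrite ler_pdivlMr ?Dist_opt_gt0//.
rewrite mulrAC ler_pdivrMr ?Dist_opt_gt0//.
by move: Dx; rewrite mulrAC ler_pdivlMr ?gap_gt0// mulrC (mulrC (Dist p X)).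
Qed.

End Sharpness.

Theorem theorem5p2 (R : realType) (m n : nat)
    (A : 'M[R]_(m, n)) (b : 'cV[R]_m) (c : 'cV[R]_n)
    (hLP : lp_assumption A b c) (eps : R) (heps : 0 < eps) :
  [/\ finite_set (M1 A b c), finite_set (M2 A b c) &
      is_min ([set R1 A b c e | e in M1 A b c] `|`
              [set R2 A b c f eps | f in M2 A b c])
             (mu_p A b c)].
Proof.
case: hLP => -[xopt Xxopt] nonopt _.
split; [exact: finite_M1|exact: finite_M2 Xxopt|].
have -> : [set R1 A b c e | e in M1 A b c] `|` [set R2 A b c f eps | f in M2 A b c]
    = G A b c @` edge_ends A b c eps.
  by rewrite /edge_ends image_setU !image_comp.
have [p Ep pmin] := sharpest_edge_end Xxopt heps nonopt.
have lb : lbound [set G A b c x | x in Fp A b `\` primal_opt A b c] (G A b c p).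
  by move=> _ [x Px <-]; exact: pmin.
have Pp := edge_ends_sub Xxopt heps Ep.
have -> : mu_p A b c = G A b c p.
  apply/eqP; rewrite eq_le; apply/andP; split.
    by apply: ge_inf; [exists (G A b c p)|exists p].
  by apply: lb_le_inf => //; exists (G A b c p), p.
split; first by exists p.
by move=> _ [q Eq <-]; exact: pmin (edge_ends_sub Xxopt heps Eq).
Qed.
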